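(* There exists an absolute constant $C>0$ such that the following holds. Let $x_1,\dots,x_n\in\mathcal{X}$ be any $n$ points, let $\mathbb{P}_n=\frac1n\sum_{i=1}^n\delta_{x_i}$, and let $\mathcal{F}$ be a convex class of functions $f:\mathcal{X}\to[-1,1]$. Then $$\inf_{f_0\in\mathcal{F}}\mathbb{E}_\xi\int(\hat f_n-f_0)^2\,d\mathbb{P}_n\;\ge\;\frac1{64}\Big(\max\{\widehat{\mathcal{W}}(\mathcal{F})-Cn^{-1},\,0\}\Big)^2 .$$
   Context: Model (fixed design): $x_1,\dots,x_n\in\mathcal{X}$ are fixed, $\xi_1,\dots,\xi_n$ are i.i.d. $N(0,1)$, and $Y_i=f_0(x_i)+\xi_i$ with $f_0\in\mathcal{F}$. The least squares estimator (ERM) is $\hat f_n=\Psi\big(\arg\min_{f\in\mathcal{F}}\sum_{i=1}^n(Y_i-f(x_i))^2\big)$, where $\Psi$ is any rule selecting one element of the set of minimizers (minimizers are assumed to exist). $\mathbb{E}_\xi$ is expectation over $\xi_1,\dots,\xi_n$. The (empirical) Gaussian average is $\widehat{\mathcal{W}}(\mathcal{F})=\mathbb{E}_\xi\sup_{f\in\mathcal{F}}\frac1n\sum_{i=1}^n\xi_if(x_i)$. *)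

(* Defs.v *)
From HB Require Import structures.
From mathcomp Require Import all_boot all_order all_algebra.
From mathcomp Require Import all_classical all_reals all_analysis.
From mathcomp Require Import measurable_realfun.

Set Implicit Arguments.
Unset Strict Implicit.
Unset Printing Implicit Defensive.

Import Order.TTheory GRing.Theory Num.Theory.
Import numFieldNormedType.Exports.

Local Open Scope classical_set_scope.
Local Open Scope ring_scope.

(* Real functions on X are typed X -> R^o, so that a class of functions
   F : set (X -> R^o) is a set in an lmodType and convexity is the library's
   convex_set. *)

(* X with the sigma-algebra of all its subsets: in the fixed design X is a bare
   set, and this makes every function on X measurable. *)
Definition discrete_space (X : pointedType) :=
  g_sigma_algebraType [set: set X].

HB.instance Definition _ (X : pointedType) :=
  Measurable.on (discrete_space X).

Section empirical_measure.
Context (R : realType) (X : pointedType) (n : nat) (x : 'I_n -> X).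
Local Open Scope ereal_scope.

Definition empirical_measure (A : set (discrete_space X)) : \bar R :=
  (n%:R^-1)%:E * \sum_(i < n) \d_(x i : discrete_space X) A.

Lemma empirical_measure_mscale_msum :
  empirical_measure =
  @mscale _ (discrete_space X) R ((n%:R^-1)%:nng)%R
    (msum (fun k => if insub k is Some i
                    then [the {measure set (discrete_space X) -> \bar R}
                          of \d_(x i : discrete_space X)]
                    else mzero) n).
Proof.
apply/funext => A; rewrite /empirical_measure /mscale /msum/=; congr (_ * _).
by apply: eq_bigr => i _; rewrite valK.
Qed.

Let empirical_measure0 : empirical_measure set0 = 0.
Proof. by rewrite empirical_measure_mscale_msum measure0. Qed.

Let empirical_measure_ge0 A : 0 <= empirical_measure A.
Proof. by rewrite empirical_measure_mscale_msum measure_ge0. Qed.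

Let empirical_measure_sigma_additive : semi_sigma_additive empirical_measure.
Proof.
rewrite empirical_measure_mscale_msum.
exact: measure_semi_sigma_additive.
Qed.

HB.instance Definition _ := isMeasure.Build _ _ _ empirical_measure
  empirical_measure0 empirical_measure_ge0 empirical_measure_sigma_additive.

Lemma Rintegral_empirical_measure (g : discrete_space X -> R) :
  (forall z, 0 <= g z)%R ->
  (\int[empirical_measure]_z g z = n%:R^-1 * \sum_(i < n) g (x i))%R.
Proof.
move=> g0; have mT (A : set (discrete_space X)) : measurable A.
  exact: sub_sigma_algebra.
have mg : measurable_fun setT (EFin \o g) by move=> _ B _; exact: mT.
rewrite /Rintegral/=.
have -> : \int[empirical_measure]_z (g z)%:E =
    (n%:R^-1 * \sum_(i < n) g (x i))%:E.
  rewrite empirical_measure_mscale_msum ge0_integral_mscale//; last first.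
    by move=> z _; rewrite lee_fin.
  rewrite ge0_integral_measure_sum//; last by move=> z _; rewrite lee_fin.
  rewrite EFinM -sumEFin; congr (_ * _); apply: eq_bigr => i _.
  by rewrite valK integral_dirac// diracT mul1e.
by [].
Qed.

End empirical_measure.
Arguments empirical_measure R {X n} x.

Section gaussian_noise.
Context d (T : measurableType d) (R : realType) (P : probability T R)
  (n : nat) (xi : 'I_n -> {RV P >-> R}).

Definition mutually_independent :=
  forall (J : {set 'I_n}) (A : 'I_n -> set R),
    (forall i, measurable (A i)) ->
    P (\bigcap_(i in [set` J]) (xi i @^-1` A i)) =
    (\prod_(i in J) P (xi i @^-1` A i))%E.

Definition iid_standard_normal :=
  mutually_independent /\
  forall i (A : set R), measurable A ->
    distribution P (xi i) A = normal_prob 0 1 A.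

End gaussian_noise.

Section least_squares.
Context (R : realType) (X : Type) (n : nat) (F : set (X -> R^o))
  (x : 'I_n -> X).

Definition squared_loss (y : 'I_n -> R) (f : X -> R^o) : R :=
  \sum_(i < n) (y i - f (x i)) ^+ 2.

Definition minimizers (y : 'I_n -> R) : set (X -> R^o) :=
  [set f | F f /\ forall g, F g -> squared_loss y f <= squared_loss y g].

Definition selects_minimizer (Psi : set (X -> R^o) -> (X -> R^o)) :=
  forall y, minimizers y !=set0 -> minimizers y (Psi (minimizers y)).

Definition least_squares (Psi : set (X -> R^o) -> (X -> R^o))
    (y : 'I_n -> R) : X -> R^o := Psi (minimizers y).

Context d (T : measurableType d) (P : probability T R)
  (xi : 'I_n -> {RV P >-> R}).

Definition response (f0 : X -> R^o) (w : T) : 'I_n -> R :=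
  fun i => f0 (x i) + xi i w.

(* The supremum is a real one: it is used for uniformly bounded F only. *)
Definition gaussian_average : \bar R :=
  'E_P[fun w => sup [set n%:R^-1 * \sum_(i < n) xi i w * f (x i) | f in F]].

End least_squares.

(* Main.v *)
(* Put h = fhat - f0 and u = f - f0 at the design points. Convexity and the
   minimality of fhat give sum (xi - h) (u - h) <= 0 for every f in F, that is,
   sum xi u <= sum h u + sum xi h - sum h^2. Since |u| <= 2, completing the
   square yields, for every mu > 0,
     2 mu sum xi u <= sum h^2 + mu^2 sum (8 + 2 xi^2).
   Divide by n, take the supremum over f and integrate: as E xi = 0 and
   E xi^2 <= 8, the risk is at least 2 mu W - 24 mu^2, where W is the Gaussian
   average. Now take mu = M / 64 for M = max (W - C / n, 0) > 0. *)

Require Import Defs.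
From HB Require Import structures.
From mathcomp Require Import all_boot all_order all_algebra.
From mathcomp Require Import all_classical all_reals all_analysis.
From mathcomp Require Import measurable_realfun ring lra.

Set Implicit Arguments.
Unset Strict Implicit.
Unset Printing Implicit Defensive.

Import Order.TTheory GRing.Theory Num.Theory.
Import numFieldNormedType.Exports.

Local Open Scope classical_set_scope.
Local Open Scope ring_scope.

(** * Comparison and linearity of integrals *)

(* The least squares risk need not be measurable in the noise: the selection
   Psi is arbitrary on the null set where no minimizer exists. *)
Lemma ae_ge0_le_integral_nonmeasurable d (T : measurableType d) (R : realType)
    (mu : {measure set T -> \bar R}) (f g : T -> \bar R) :
  measurable_fun setT f -> (forall x, 0 <= f x)%E -> (forall x, 0 <= g x)%E ->
  {ae mu, forall x, (f x <= g x)%E} ->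
  (\int[mu]_x f x <= \int[mu]_x g x)%E.
Proof.
move=> mf f0 g0 [N [mN N0 fgN]].
(* Setting [f] to 0 on the null set [N] keeps its integral and gives [f <= g] everywhere. Every
   simple function below [f] then competes in the supremum that defines the integral of [g]. *)
rewrite (ge0_negligible_integral mN) // setTD integral_mkcond.
rewrite !ge0_integralTE //; last by move=> x; exact: erestrict_ge0.
apply: le_ereal_sup => _ [h hf <-]; exists h => // x.
apply: (le_trans (hf x)); rewrite patchE; case: ifPn => // /set_mem Nx.
by move/subsetCl: fgN; apply.
Qed.

Lemma integral_lincomb d (T : measurableType d) (R : realType)
    (mu : {measure set T -> \bar R}) (n : nat) (c : 'I_n -> R)
    (Y : 'I_n -> T -> R) :
  (forall i, mu.-integrable setT (EFin \o Y i)) ->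
  mu.-integrable setT (fun w => (\sum_(i < n) c i * Y i w)%:E) /\
  (\int[mu]_w (\sum_(i < n) c i * Y i w)%:E =
   \sum_(i < n) (c i)%:E * \int[mu]_w (Y i w)%:E)%E.
Proof.
move=> iY.
have icY i : mu.-integrable setT (fun w => (c i)%:E * (Y i w)%:E)%E.
  exact: (integrableZl measurableT (c i) (iY i)).
have -> : (fun w => (\sum_(i < n) c i * Y i w)%:E) =
    (fun w => \sum_(i < n) (c i)%:E * (Y i w)%:E)%E.
  by apply/funext => w; rewrite -sumEFin.
split; first exact: integrable_sum.
rewrite integral_sum //; apply: eq_bigr => i _.
by rewrite -integralZl //; exact: iY.
Qed.

(** * First two moments of the standard normal law *)

(** The Radon-Nikodym derivative and [normal_pdf] have the same integral over every measurable set,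
    hence agree almost everywhere. *)
Lemma ge0_integral_normal_prob (R : realType) (m s : R) (f : R -> \bar R) :
  measurable_fun setT f -> (forall x, 0 <= f x)%E ->
  (\int[normal_prob m s]_x f x =
   \int[lebesgue_measure]_x (f x * (normal_pdf m s x)%:E))%E.
Proof.
move=> mf f0.
have dom : normal_prob m s `<< (@lebesgue_measure R).
  exact: normal_prob_dominates.
rewrite -(Radon_Nikodym_SigmaFinite.change_of_variables dom) //.
have mpdf : measurable_fun setT (EFin \o normal_pdf m s).
  by apply/measurable_EFinP; exact: measurable_normal_pdf.
have iRN := Radon_Nikodym_SigmaFinite.f_integrable dom.
apply: ae_eq_integral => //.
- by apply: emeasurable_funM => //; exact: measurable_int iRN.
- exact: emeasurable_funM.
- apply: ae_eqe_mul2l; apply: integral_ae_eq => // A _ mA.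
  by rewrite -Radon_Nikodym_SigmaFinite.f_integral.
Qed.

(** Both the centred density and Lebesgue measure are invariant under [x -> - x]. *)
Lemma ge0_integral_normal_probN (R : realType) (s : R) (f : R -> \bar R) :
  s != 0 -> measurable_fun setT f -> (forall x, 0 <= f x)%E ->
  (\int[normal_prob 0 s]_x f (- x)%R = \int[normal_prob 0 s]_x f x)%E.
Proof.
move=> s0 mf f0.
have mN : measurable_fun setT (-%R : R -> R) by exact: oppr_measurable.
rewrite !ge0_integral_normal_prob //; last exact: measurableT_comp.
pose g := fun x => (f x * (normal_pdf 0 s x)%:E)%E.
have mg : measurable_fun setT g.
  apply: emeasurable_funM => //.
  by apply/measurable_EFinP; exact: measurable_normal_pdf.
have g0 x : (0 <= g x)%E by rewrite mule_ge0 // lee_fin normal_pdf_ge0.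
transitivity (\int[lebesgue_measure]_x (g \o -%R) x)%E.
  apply: eq_integral => x _; rewrite /g /= !normal_pdfE //.
  by rewrite /normal_fun !subr0 sqrrN.
rewrite -(@ge0_integral_pushforward _ _ (measurableTypeR R) (measurableTypeR R)
  R -%R mN lebesgue_measure setT) //.
by apply: eq_measure_integral => A mA _; exact: lebesgue_measureN.
Qed.

(* [x^2 / 4 <= exp (x^2 / 4)] trades the factor [x^2] for a wider Gaussian. *)
Lemma standard_normal_sqr_le (R : realType) :
  (\int[normal_prob (0 : R) 1]_x (x ^+ 2)%:E <= 8%:E)%E.
Proof.
have msqr : measurable_fun setT (fun x : R => (x ^+ 2)%:E).
  by apply/measurable_EFinP; exact: measurable_funX.
rewrite ge0_integral_normal_prob //; last first.
  by move=> x; rewrite lee_fin sqr_ge0.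
have n20 : (2 : R) != 0 by [].
(* The bound is 8 times the mass of the normal law of standard deviation 2: a factor 4 from
   [x^2 <= 4 exp (x^2 / 4)] and a factor 2 from the ratio of the peaks. *)
rewrite -[leRHS]mule1 -(integral_normal_pdf 0 (2 : R)).
rewrite -integralZl //; last exact: integrable_normal_pdf.
apply: ge0_le_integral => //.
- by move=> x _; rewrite mule_ge0 // lee_fin ?sqr_ge0 ?normal_pdf_ge0.
- apply: emeasurable_funM => //.
  by apply/measurable_EFinP; exact: measurable_normal_pdf.
- apply: emeasurable_funM => //.
  by apply/measurable_EFinP; exact: measurable_normal_pdf.
move=> x _; rewrite -!EFinM lee_fin !normal_pdfE // ?oner_eq0 //.
rewrite /normal_fun !subr0.
have -> : normal_peak (1 : R) = 2 * normal_peak (2 : R).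
  rewrite /normal_peak.
  have -> : (2 : R) ^+ 2 * pi *+ 2 = 2 ^+ 2 * (1 ^+ 2 * pi *+ 2) by ring.
  by rewrite sqrtrM ?sqr_ge0 // sqrtr_sqr ger0_norm // invfM mulVKf.
set a := normal_peak 2; set e1 := expR _; set e2 := expR _.
suff le_e : x ^+ 2 * e1 <= 4 * e2.
  have -> : x ^+ 2 * (2 * a * e1) = 2 * a * (x ^+ 2 * e1) by ring.
  have -> : 8 * (a * e2) = 2 * a * (4 * e2) by ring.
  by rewrite ler_wpM2l // mulr_ge0 // normal_peak_ge0.
rewrite {}/e1 {}/e2.
have ex := expR_ge1Dx (x ^+ 2 / 4).
have x2 := sqr_ge0 x.
apply: (@le_trans _ _
  (4 * expR (x ^+ 2 / 4) * expR (- x ^+ 2 / (1 ^+ 2 *+ 2)))).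
  by rewrite ler_wpM2r ?expR_ge0 //; lra.
rewrite -mulrA -expRD ler_pM2l // ler_expR.
by rewrite expr1n; lra.
Qed.

Lemma ge0_integral_normal_law d (T : measurableType d) (R : realType)
    (P : probability T R) (X : {RV P >-> R}) (m s : R) (f : R -> \bar R) :
  (forall A, measurable A -> distribution P X A = normal_prob m s A) ->
  measurable_fun setT f -> (forall x, 0 <= f x)%E ->
  (\int[normal_prob m s]_x f x = \int[P]_w f (X w))%E.
Proof.
move=> XN mf f0.
have mX : measurable_fun setT (X : T -> measurableTypeR R).
  by have := @measurable_funPT _ _ _ _ X.
transitivity (\int[P]_w (f \o (X : T -> measurableTypeR R)) w)%E => //.
rewrite -(ge0_integral_pushforward mX P measurableT mf) //.
by apply: eq_measure_integral => A mA _; exact/esym/XN.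
Qed.

Lemma standard_normal_integrable_sqr d (T : measurableType d) (R : realType)
    (P : probability T R) (X : {RV P >-> R}) :
  (forall A, measurable A -> distribution P X A = normal_prob 0 1 A) ->
  P.-integrable setT (fun w => (X w ^+ 2)%:E) /\
  (\int[P]_w (X w ^+ 2)%:E <= 8%:E)%E.
Proof.
move=> XN.
have msqr : measurable_fun setT (fun x : R => (x ^+ 2)%:E).
  by apply/measurable_EFinP; exact: measurable_funX.
have mX2 : measurable_fun setT (fun w => (X w ^+ 2)%:E).
  by apply: (measurableT_comp msqr); exact: measurable_funPT.
have X2le : (\int[P]_w (X w ^+ 2)%:E <= 8%:E)%E.
  rewrite -(ge0_integral_normal_law XN msqr).
    exact: standard_normal_sqr_le.
  by move=> x; rewrite lee_fin sqr_ge0.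
split => //; apply/integrableP; split => //.
apply: le_lt_trans (ltry (8 : R)); apply: le_trans X2le.
by under eq_integral do rewrite /= ger0_norm ?sqr_ge0 //.
Qed.

(** By symmetry the positive and negative parts have equal integrals. These are finite since
    [|x| <= 1 + x^2], so their difference is 0. *)
Lemma standard_normal_mean0 d (T : measurableType d) (R : realType)
    (P : probability T R) (X : {RV P >-> R}) :
  (forall A, measurable A -> distribution P X A = normal_prob 0 1 A) ->
  P.-integrable setT (EFin \o X) /\ (\int[P]_w (X w)%:E = 0)%E.
Proof.
move=> XN.
have [iX2 _] := standard_normal_integrable_sqr XN.
have mX : measurable_fun setT (EFin \o X) by exact/measurable_EFinP.
have iX : P.-integrable setT (EFin \o X).
  apply: (@le_integrable _ _ _ P _ measurableT _
    (fun w => 1%:E + (X w ^+ 2)%:E)%E) => //.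
    move=> w _; rewrite -EFinD !abse_EFin lee_fin [leRHS]ger0_norm; last first.
      by rewrite addr_ge0 ?sqr_ge0.
    by rewrite -(real_normK (num_real (X w))) /=; nra.
  apply: integrableD => //.
  exact: finite_measure_integrable_cst.
split => //.
pose f (x : R) := ((EFin : R -> \bar R)^\+ x)%E.
have mid : measurable_fun setT (EFin : R -> \bar R) by exact/measurable_EFinP.
have mf : measurable_fun setT f by exact: measurable_funepos.
have f0 x : (0 <= f x)%E by exact: funepos_ge0.
have mfN : measurable_fun setT (f \o -%R : R -> \bar R).
  by apply: (measurableT_comp mf); exact: oppr_measurable.
rewrite integralE.
have -> : (\int[P]_w (EFin \o X)^\- w = \int[P]_w f (- X w)%R)%E.
  apply: eq_integral => w _.
  by rewrite /f funeposE funenegE.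
have Xp : (\int[P]_w (EFin \o X)^\+ w = \int[P]_w f (X w))%E.
  by apply: eq_integral => w _; rewrite /f !funeposE.
rewrite Xp -(ge0_integral_normal_law XN mf f0).
rewrite -(ge0_integral_normal_law XN mfN) //=.
rewrite ge0_integral_normal_probN ?oner_eq0 // subee //.
rewrite (ge0_integral_normal_law XN mf f0) -Xp.
exact: integrable_pos_fin_num iX.
Qed.

(** * Measurability of the supremum over the class *)

(** There are countably many boxes with rational centre and radius [1 / (m + 1)]; one member of [F]
    is chosen in each box that meets [F]. This reduces a supremum over an uncountable class to a
    countable one. *)
Lemma countable_dense_coords (R : realType) (I : Type) (n : nat) (F : set I)
    (phi : I -> 'I_n -> R) : F !=set0 ->
  exists g : nat -> I, (forall k, F (g k)) /\
    forall f e, F f -> 0 < e ->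
      exists k, forall i, `|phi f i - phi (g k) i| <= e.
Proof.
move=> [f0 Ff0].
pose near (c : {ffun 'I_n -> rat} * nat) f :=
  F f /\ forall i, `|phi f i - ratr (c.1 i)| < c.2.+1%:R^-1.
have /choice[h hP] c : exists f, F f /\ ((exists f', near c f') -> near c f).
  have [[f' nf']|nex] := pselect (exists f', near c f').
    by exists f'; split => //; case: nf'.
  by exists f0; split => // /nex.
(* Indices that code no box are sent to the default member [f0]. *)
exists (fun k => if unpickle k is Some c then h c else f0); split.
  by move=> k; case: unpickle => // c; case: (hP c).
move=> f e Ff e0.
(* Two members of one box differ by at most twice its radius. *)
have [m me] : exists m : nat, 2 * m.+1%:R^-1 <= e.
  exists (Num.bound (2 / e)).
  rewrite -ler_pdivlMr ?invr_gt0 ?ltr0n // invrK mulrC -ler_pdivrMr //.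
  rewrite ltW // (lt_le_trans (archi_boundP _)) ?ler_nat //.
  by rewrite divr_ge0 // ltW.
have q_ i : exists q : rat, `|phi f i - ratr q| < m.+1%:R^-1.
  have /rat_in_itvoo[q] : phi f i - m.+1%:R^-1 < phi f i + m.+1%:R^-1.
    by rewrite ltrBlDr -addrA ltrDl addr_gt0 // invr_gt0.
  rewrite in_itv /= => qf; exists q.
  by rewrite distrC ltr_distl.
have [q qP] := choice q_.
pose c : {ffun 'I_n -> rat} * nat := ([ffun i => q i], m).
have nf : near c f by split => // i; rewrite ffunE.
exists (pickle c); rewrite pickleK => i.
have [_ /(_ (ex_intro _ f nf)) [_ /(_ i)]] := hP c.
rewrite /= ffunE => h1; have h2 := qP i.
apply: le_trans me.
rewrite -(subrKA (ratr (q i))) (le_trans (ler_normD _ _)) //.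
by rewrite (distrC (ratr _)) mulr_natl mulr2n lerD // ltW.
Qed.

Lemma ler_norm_sum_bounded (R : realDomainType) (n : nat) (a v : 'I_n -> R)
    (e : R) :
  (forall i, `|v i| <= e) ->
  `|\sum_(i < n) a i * v i| <= e * \sum_(i < n) `|a i|.
Proof.
move=> ve; rewrite (le_trans (ler_norm_sum _ _ _)) // mulr_sumr.
by apply: ler_sum => i _; rewrite normrM mulrC ler_wpM2r.
Qed.

(** For fixed [w] the sum is Lipschitz in the coordinates of [f], so the dense sequence [g] attains
    the same supremum, and a countable supremum of measurable functions is measurable. *)
Lemma measurable_sup_lincomb d (T : measurableType d) (R : realType) (I : Type)
    (n : nat) (F : set I) (phi : I -> 'I_n -> R) (a : 'I_n -> T -> R) :
  F !=set0 -> (forall f i, F f -> `|phi f i| <= 1) ->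
  (forall i, measurable_fun setT (a i)) ->
  measurable_fun setT
    (fun w => sup [set \sum_(i < n) a i w * phi f i | f in F]).
Proof.
move=> F0 phi1 ma.
have [g [Fg gdense]] := countable_dense_coords phi F0.
pose u k w := \sum_(i < n) a i w * phi (g k) i.
have ub w f : F f -> \sum_(i < n) a i w * phi f i <= \sum_(i < n) `|a i w|.
  move=> Ff; rewrite (le_trans (ler_norm _)) //.
  rewrite -[leRHS]mul1r; apply: ler_norm_sum_bounded => i.
  exact: phi1.
have hub w : has_ubound (range (u ^~ w)).
  by exists (\sum_(i < n) `|a i w|) => _ [k _ <-]; exact: ub.
suff -> : (fun w => sup [set \sum_(i < n) a i w * phi f i | f in F]) =
    (fun w => sups (u ^~ w) 0).
  apply: measurable_fun_sups => // k; apply: measurable_sum => i.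
  by apply: measurable_funM.
apply/funext => w; rewrite /sups /sdrop /=.
have -> : [set u k w | k in [set k | (0 <= k)%N]] = range (u ^~ w).
  by apply/seteqP; split => _ [k _ <-]; exists k.
apply/eqP; rewrite eq_le; apply/andP; split.
  apply: ge_sup.
    by have [f Ff] := F0; exists (\sum_(i < n) a i w * phi f i), f.
  move=> _ [f Ff <-]; apply/ler_addgt0Pr => e e0.
  pose s := \sum_(i < n) `|a i w|.
  have s1 : 0 < 1 + s by rewrite ltr_wpDr // sumr_ge0.
  (* The error in the sum is at most the tolerance times [s]; the added 1 keeps the denominator
     positive when all coefficients vanish. *)
  have [k kP] := gdense f (e / (1 + s)) Ff (divr_gt0 e0 s1).
  have uk : u k w <= sup (range (u ^~ w)).
    by apply: ub_le_sup; [exact: hub | exists k].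
  rewrite -lerBlDl (le_trans (lerB (lexx _) uk)) //.
  rewrite -sumrB; under eq_bigr do rewrite -mulrBr.
  rewrite (le_trans (ler_norm _)) // (le_trans (ler_norm_sum_bounded _ kP)) //.
  rewrite mulrAC ler_pdivrMr // ler_pM2l //.
  by rewrite -/s lerDr.
apply: ge_sup; first by exists (u 0%N w), 0%N.
move=> _ [k _ <-]; apply: ub_le_sup; last by exists (g k).
by exists (\sum_(i < n) `|a i w|) => _ [f Ff <-]; exact: ub.
Qed.

(** * Deterministic least squares inequality *)

(** First-order optimality of a projection: if the inner product [s] were positive, a short step
    along [q] would shrink the norm of [p]. *)
Lemma projection_ineq (R : realFieldType) (n : nat) (p q : 'I_n -> R) :
  (forall t, 0 <= t <= 1 ->
    \sum_(i < n) p i ^+ 2 <= \sum_(i < n) (p i - t * q i) ^+ 2) ->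
  \sum_(i < n) p i * q i <= 0.
Proof.
move=> pmin; set s := \sum_(i < n) _.
pose Q := \sum_(i < n) q i ^+ 2.
have Q0 : 0 <= Q by rewrite sumr_ge0 // => i _; rewrite sqr_ge0.
rewrite leNgt; apply/negP => s0.
have sQ : 0 < s + Q by rewrite ltr_wpDr.
(* This step length lies in [[0, 1]], even when [Q = 0]. Minimality would force [2 s <= t Q],
   whereas [t Q = s - t s < s]. *)
pose t := s / (s + Q).
have tsQ : t * (s + Q) = s by rewrite divfK // gt_eqF.
have t0 : 0 < t by rewrite divr_gt0.
have t1 : t <= 1 by rewrite ler_pdivrMr // mul1r lerDl.
have : 0 <= t <= 1 by rewrite ltW.
move=> /pmin.
have -> : \sum_(i < n) (p i - t * q i) ^+ 2 =
    \sum_(i < n) p i ^+ 2 - 2 * t * s + t ^+ 2 * Q.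
  rewrite !mulr_sumr -sumrB -big_split /=.
  by apply: eq_bigr => i _; ring.
move=> pt; have : t * (2 * s) <= t * (t * Q) by lra.
by rewrite ler_pM2l // => ?; nra.
Qed.

Lemma least_squares_basic_ineq (R : realFieldType) (n : nat)
    (v0 vhat v xi : 'I_n -> R) (mu : R) :
  0 <= mu -> (forall i, `|v i - v0 i| <= 2) ->
  (forall t, 0 <= t <= 1 ->
    \sum_(i < n) (v0 i + xi i - vhat i) ^+ 2 <=
    \sum_(i < n) (v0 i + xi i - (t * v i + (1 - t) * vhat i)) ^+ 2) ->
  2 * mu * \sum_(i < n) xi i * (v i - v0 i) <=
  \sum_(i < n) (vhat i - v0 i) ^+ 2 +
    mu ^+ 2 * \sum_(i < n) (8 + 2 * xi i ^+ 2).
Proof.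
move=> mu0 u2 vmin.
have : \sum_(i < n) (v0 i + xi i - vhat i) * (v i - vhat i) <= 0.
  apply: projection_ineq => t /vmin /le_trans; apply.
  by apply: ler_sum => i _; rewrite le_eqVlt; apply/predU1P; left; ring.
set s := \sum_(i < n) (_ * (v i - vhat i)) => s0.
apply: (@le_trans _ _ (2 * mu * (\sum_(i < n) xi i * (v i - v0 i) - s))).
  by rewrite ler_wpM2l ?mulr_ge0 // lerBrDr gerDl.
rewrite -sumrB !mulr_sumr -big_split /=; apply: ler_sum => i _.
have := u2 i; rewrite ler_norml => /andP[ua ub].
have : (v i - v0 i) ^+ 2 <= 4 by nra.
set u := v i - v0 i; set h := vhat i - v0 i => u4.
have -> : xi i * u - (v0 i + xi i - vhat i) * (v i - vhat i) =
   h * u + xi i * h - h ^+ 2 by rewrite /h /u; ring.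
(* The claim is [h1 + h2 + 2 h3 + 2 h4]: [h1] completes the square, [h2] gives
   [(u + xi)^2 <= 2 u^2 + 2 xi^2], [h3] drops [- 2 mu h^2], and [h4] turns [2 u^2] into 8. *)
have h1 := sqr_ge0 (h - mu * (u + xi i)).
have h2 := sqr_ge0 (mu * (u - xi i)).
have h3 : 0 <= mu * h ^+ 2 by rewrite mulr_ge0 ?sqr_ge0.
have h4 : 0 <= mu ^+ 2 * (4 - u ^+ 2) by rewrite mulr_ge0 ?sqr_ge0 ?subr_ge0.
nra.
Qed.

Lemma convex_set_comb (R : numDomainType) (M : lmodType R) (A : set M)
    (f g : M) (t : R) :
  convex_set A -> A f -> A g -> 0 <= t <= 1 -> A (t *: f + (1 - t) *: g).
Proof.
move=> cA Af Ag /andP[t0 t1].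
have := cA f g (Itv01 t0 t1) (mem_set Af) (mem_set Ag).
by rewrite inE.
Qed.

Lemma least_squares_pathwise (R : realType) (X : Type) (n : nat)
    (F : set (X -> R^o)) (x : 'I_n -> X) (Psi : set (X -> R^o) -> (X -> R^o))
    (f0 : X -> R^o) (xi : 'I_n -> R) (mu : R)
    (y := fun i => f0 (x i) + xi i) :
  convex_set F -> (forall f, F f -> forall z, -1 <= f z <= 1) ->
  selects_minimizer F x Psi -> F f0 -> minimizers F x y !=set0 -> 0 < mu ->
  2 * mu * (sup [set n%:R^-1 * \sum_(i < n) xi i * f (x i) | f in F] -
            n%:R^-1 * \sum_(i < n) xi i * f0 (x i)) <=
  n%:R^-1 * \sum_(i < n) (least_squares F x Psi y (x i) - f0 (x i)) ^+ 2 +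
    mu ^+ 2 * (n%:R^-1 * \sum_(i < n) (8 + 2 * xi i ^+ 2)).
Proof.
move=> cF F1 selPsi Ff0 /selPsi[]; rewrite -/(least_squares F x Psi y).
set fhat := least_squares F x Psi y => Fhat hatmin mu0.
have mu20 : 0 < 2 * mu by rewrite mulr_gt0.
(* Isolating the supremum turns the claim into an upper bound to be checked for each [f]
   separately. *)
rewrite -ler_pdivlMl // lerBlDr.
apply: ge_sup.
  by exists (n%:R^-1 * \sum_(i < n) xi i * f0 (x i)), f0.
move=> _ [f Ff <-]; rewrite -lerBlDr ler_pdivlMl //.
rewrite [mu ^+ 2 * _]mulrCA -mulrBr -mulrDr [leLHS]mulrCA.
rewrite ler_wpM2l ?invr_ge0 //.
rewrite -sumrB; under eq_bigr do rewrite -mulrBr.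
apply: (@least_squares_basic_ineq _ _ (f0 \o x) (fhat \o x) (f \o x)) => /=.
- exact: ltW.
- move=> i; have /andP[? ?] := F1 _ Ff (x i).
  have /andP[? ?] := F1 _ Ff0 (x i).
  by rewrite ler_norml; apply/andP; split; lra.
- move=> t t01; exact: hatmin (convex_set_comb cF Ff Fhat t01).
Qed.

(** * Integration over the noise *)

(** Since [|f| <= 1], the supremum is dominated in absolute value by the average of the [|xi i|]; a
    member of [F] supplies the lower bound. *)
Lemma integrable_gaussian_sup d (T : measurableType d) (R : realType)
    (P : probability T R) (X : Type) (n : nat) (F : set (X -> R^o))
    (x : 'I_n -> X) (xi : 'I_n -> {RV P >-> R}) :
  (forall f, F f -> forall z, -1 <= f z <= 1) ->
  (forall i, P.-integrable setT (EFin \o xi i)) -> F !=set0 ->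
  P.-integrable setT (fun w =>
    (sup [set n%:R^-1 * \sum_(i < n) xi i w * f (x i) | f in F])%:E).
Proof.
move=> F1 ixi F0; pose a i w := n%:R^-1 * xi i w.
pose b w := \sum_(i < n) 1 * `|a i w|.
have f1 f i : F f -> `|f (x i)| <= 1.
  by move=> Ff; rewrite ler_norml; exact: F1.
have -> : (fun w => (sup [set n%:R^-1 * \sum_(i < n) xi i w * f (x i)
      | f in F])%:E) =
    (fun w => (sup [set \sum_(i < n) a i w * f (x i) | f in F])%:E).
  apply/funext => w; congr (sup _)%:E; apply/eq_imagel => f _.
  by rewrite mulr_sumr; apply: eq_bigr => i _; rewrite mulrA.
have ma i : measurable_fun setT (a i) by exact: measurable_funM.
have ub w f : F f -> `|\sum_(i < n) a i w * f (x i)| <= b w.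
  move=> Ff; rewrite /b -mulr_sumr; apply: ler_norm_sum_bounded => i.
  exact: f1.
apply: (@le_integrable _ _ _ P _ measurableT _ (EFin \o b)) => //.
- apply/measurable_EFinP.
  exact: (@measurable_sup_lincomb _ _ _ _ _ F (fun f i => f (x i))).
- move=> w _; rewrite !abse_EFin lee_fin [leRHS]ger0_norm; last first.
    by rewrite sumr_ge0 // => i _; rewrite mulr_ge0.
  rewrite ler_norml; apply/andP; split.
    have [f Ff] := F0.
    apply: (@le_trans _ _ (\sum_(i < n) a i w * f (x i))).
      by have := ub w f Ff; rewrite ler_norml => /andP[].
    apply: ub_le_sup; last by exists f.
    by exists (b w) => _ [g Fg <-]; rewrite (le_trans (ler_norm _)) // ub.
  apply: ge_sup.
    by have [f Ff] := F0; exists (\sum_(i < n) a i w * f (x i)), f.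
  by move=> _ [g Fg <-]; rewrite (le_trans (ler_norm _)) // ub.
- have ia i : P.-integrable setT (EFin \o (fun w => `|a i w|)).
    apply: integrable_norm => //.
    exact: (integrableZl measurableT _ (ixi i)).
  exact: (integral_lincomb (fun=> 1) ia).1.
Qed.

Theorem corollary3p1 (R : realType) :
  exists C : R, 0 < C /\
  forall (n : nat) (X : pointedType) (x : 'I_n -> X) (F : set (X -> R^o))
    (Psi : set (X -> R^o) -> (X -> R^o))
    (d : measure_display) (T : measurableType d) (P : probability T R)
    (xi : 'I_n -> {RV P >-> R}),
  (0 < n)%N ->
  convex_set F ->
  (forall f, F f -> forall z, -1 <= f z <= 1) ->
  iid_standard_normal xi ->
  (forall f0, F f0 ->
     {ae P, forall w, minimizers F x (response x xi f0 w) !=set0}) ->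
  selects_minimizer F x Psi ->
  ((64^-1)%:E *
     (maxe (gaussian_average F x xi - (C * n%:R^-1)%:E) 0) ^+ 2 <=
   ereal_inf
     [set 'E_P[fun w =>
        (\int[(empirical_measure R x
               : {measure set (discrete_space X) -> \bar R})]_z
           (least_squares F x Psi (response x xi f0 w) z - f0 z) ^+ 2)%R]
     | f0 in F])%E.
Proof.
(* Any positive constant would do: [C] enters through [M <= W]. *)
exists 1; split=> // n X x F Psi d T P xi n0 cF F1 [_ xiN] minae selPsi.
apply: le_ereal_inf_tmp => _ [f0 Ff0 <-].
have ixi i : P.-integrable setT (EFin \o xi i).
  exact: (standard_normal_mean0 (xiN i)).1.
have nV0 : 0 <= n%:R^-1 :> R by rewrite invr_ge0.
pose S w := sup [set n%:R^-1 * \sum_(i < n) xi i w * f (x i) | f in F].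
have iS : P.-integrable setT (EFin \o S).
  by apply: integrable_gaussian_sup => //; exists f0.
(* The cost of centring the class at [f0], which has mean 0. *)
pose L w := \sum_(i < n) (n%:R^-1 * f0 (x i)) * xi i w.
have [iL intL] :
    P.-integrable setT (EFin \o L) /\ (\int[P]_w (L w)%:E = 0)%E.
  have [iL intL] := integral_lincomb (fun i => n%:R^-1 * f0 (x i)) ixi.
  split; first exact: iL.
  rewrite intL big1 // => i _.
  by rewrite (standard_normal_mean0 (xiN i)).2 mule0.
(* The remainder multiplying [mu^2]; its mean is at most [8 + 2 * 8 = 24]. *)
pose B w := 8 + \sum_(i < n) (2 * n%:R^-1) * xi i w ^+ 2.
have [iB intB] :
    P.-integrable setT (EFin \o B) /\ (\int[P]_w (B w)%:E <= 24%:E)%E.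
  have ixi2 i : P.-integrable setT (EFin \o (fun w => xi i w ^+ 2)).
    exact: (standard_normal_integrable_sqr (xiN i)).1.
  have [iV intV] := integral_lincomb (fun=> 2 * n%:R^-1) ixi2.
  have i8 : P.-integrable setT (EFin \o cst (8 : R)).
    exact: finite_measure_integrable_cst.
  split; first exact: (integrableD measurableT i8 iV).
  under eq_integral do rewrite EFinD.
  rewrite (integralD_EFin measurableT i8 iV) intV.
  have -> : (\int[P]_w 8%:E = 8%:E)%E.
    by have := expectation_cst P 8; rewrite unlock.
  have -> : 24%:E = (8%:E + \sum_(i < n) (2 * n%:R^-1)%:E * 8%:E)%E :> \bar R.
    rewrite sumEFin -EFinD; congr _%:E.
    rewrite sumr_const card_ord -mulr_natl; field.
    by rewrite pnatr_eq0 -lt0n.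
  rewrite leeD2l //; apply: lee_sum => i _; apply: lee_wpmul2l.
    by rewrite lee_fin mulr_ge0.
  exact: (standard_normal_integrable_sqr (xiN i)).2.
pose W := fine (\int[P]_w (S w)%:E)%E.
have WE : gaussian_average F x xi = W%:E.
  by rewrite /gaussian_average unlock fineK // integrable_fin_num.
pose M := Num.max (W - 1 * n%:R^-1) 0.
rewrite WE -EFinB -EFin_max -/M -EFin_expe -EFinM unlock.
have DE w : (\int[(empirical_measure R x
    : {measure set (discrete_space X) -> \bar R})]_z
      (least_squares F x Psi (response x xi f0 w) z - f0 z) ^+ 2)%R =
    n%:R^-1 * \sum_(i < n)
      (least_squares F x Psi (response x xi f0 w) (x i) - f0 (x i)) ^+ 2.
  rewrite (Rintegral_empirical_measure x
    (g := fun z =>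
      (least_squares F x Psi (response x xi f0 w) z - f0 z) ^+ 2)) //.
  by move=> z; exact: sqr_ge0.
have D0 w : 0 <= n%:R^-1 * \sum_(i < n)
    (least_squares F x Psi (response x xi f0 w) (x i) - f0 (x i)) ^+ 2.
  by rewrite mulr_ge0 // sumr_ge0 // => i _; rewrite sqr_ge0.
under eq_integral do rewrite DE.
have [M0|M0] := leP M 0.
  have -> : M = 0 by apply/le_anti; rewrite M0 le_max lexx orbT.
  rewrite expr0n mulr0; apply: integral_ge0 => w _.
  by rewrite lee_fin.
have MW : M <= W.
  move: (M0); rewrite lt_max ltxx orbF => W0.
  by rewrite /M max_l ?(ltW W0) // mul1r gerBl.
(* As [M <= W], [2 mu W >= M^2 / 32], while [24 mu^2 = 3 M^2 / 512] is below [M^2 / 64]; at least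
   [M^2 / 64] is left. *)
pose mu := M / 64.
have mu0 : 0 < mu by rewrite divr_gt0.
pose G w := 2 * mu * (S w - L w) - mu ^+ 2 * B w.
have iSL : P.-integrable setT (EFin \o (fun w => S w - L w)).
  exact: (integrableB measurableT iS iL).
have i1 := integrableZl measurableT (2 * mu) iSL.
have i2 := integrableZl measurableT (mu ^+ 2) iB.
have iG : P.-integrable setT (EFin \o G).
  exact: (integrableB measurableT i1 i2).
have intG : ((64^-1 * M ^+ 2)%:E <= \int[P]_w (G w)%:E)%E.
  have -> : (\int[P]_w (G w)%:E = (2 * mu)%:E * \int[P]_w (S w)%:E -
      (mu ^+ 2)%:E * \int[P]_w (B w)%:E)%E.
    transitivity (\int[P]_w ((2 * mu)%:E * (S w - L w)%:E) -
        \int[P]_w ((mu ^+ 2)%:E * (B w)%:E))%E.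
      exact: (integralB measurableT i1 i2).
    rewrite !integralZl //; congr (_ * _ - _)%E.
    transitivity (\int[P]_w (S w)%:E - \int[P]_w (L w)%:E)%E.
      exact: (integralB measurableT iS iL).
    by rewrite intL sube0.
  rewrite -[(\int[P]_w (S w)%:E)%E]fineK ?integrable_fin_num // -/W.
  apply: (@le_trans _ _ (2 * mu * W - mu ^+ 2 * 24)%:E).
    by rewrite lee_fin /mu; nra.
  rewrite EFinB (EFinM (2 * mu)) (EFinM (mu ^+ 2)) leeB // lee_wpmul2l //.
  by rewrite lee_fin sqr_ge0.
apply: (le_trans intG).
(* [G] may be negative; its positive part is a measurable nonnegative minorant, as the comparison
   with the possibly nonmeasurable risk requires. *)
apply: (@le_trans _ _ (\int[P]_w (Num.max (G w) 0)%:E)%E).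
  apply: le_integral => //.
    exact: integrable_funrpos.
  by move=> w _; rewrite lee_fin le_max lexx.
apply: ae_ge0_le_integral_nonmeasurable.
- apply/measurable_EFinP; apply: measurable_maxr => //.
  by have /integrableP[/measurable_EFinP] := iG.
- by move=> w; rewrite lee_fin le_max lexx orbT.
- by move=> w; rewrite lee_fin.
(* Almost surely a minimizer exists, and there the pathwise inequality bounds [G] by the loss. *)
apply: filterS (minae f0 Ff0) => w ne; rewrite lee_fin ge_max D0 andbT.
rewrite /G lerBlDr.
have := least_squares_pathwise cF F1 selPsi Ff0 ne mu0.
congr (_ * (_ - _) <= _ + _ * _).
  by rewrite /L mulr_sumr; apply: eq_bigr => i _; ring.
rewrite big_split /= sumr_const card_ord mulrDr /B; congr (_ + _).
  by rewrite -[8 *+ n]mulr_natl mulKf // pnatr_eq0 -lt0n.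
by rewrite mulr_sumr; apply: eq_bigr => i _; ring.
Qed.
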